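(* Let $X$ be a Tychonoff space and let $\lambda$ be a family of non-empty closed subsets of $X$ which is a $\pi$-network for $X$ and is closed under finite unions of its elements. Then the following statements are equivalent. (1) $C_{\lambda}(X)=C_{\lambda,u}(X)$ (the $\lambda$-open topology and the $\lambda$-topology on $C(X)$ coincide). (2) $C_{\lambda}(X)$ is a paratopological group (under pointwise addition). (3) $C_{\lambda}(X)$ is a topological group (under pointwise addition). (4) $C_{\lambda}(X)$ is a topological vector space. (5) $C_{\lambda}(X)$ is a locally convex topological vector space. (6) $C_{\lambda}(X)$ is a topological ring. (7) $C_{\lambda}(X)$ is a topological algebra (under the usual pointwise operations of addition, multiplication, and multiplication by real scalars). (8) $\lambda$ is a family of $C$-compact subsets of $X$ and $\lambda=\lambda(C)$. (9) $\lambda_m$ is a family of $C$-compact subsets of $X$ and it is hereditary with respect to $C$-compact subsets.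
   Context: $C(X)$ is the set of all continuous real-valued functions on $X$, with the usual pointwise operations. For a family $\lambda$ of non-empty subsets of $X$: - $C_\lambda(X)$ is $C(X)$ with the $\lambda$-open topology, whose subbase consists of all sets $[F,U]=\{f\in C(X): f(F)\subseteq U\}$ with $F\in\lambda$ and $U\subseteq\mathbb{R}$ open. - $C_{\lambda,u}(X)$ is $C(X)$ with the $\lambda$-topology (uniform convergence on elements of $\lambda$), in which the sets $\langle f,F,\varepsilon\rangle=\{g\in C(X): \sup_{x\in F}|f(x)-g(x)|<\varepsilon\}$, $F\in\lambda$, $\varepsilon>0$, are the standard basic neighborhoods of $f\in C(X)$. A family $\lambda$ of non-empty subsets of $X$ is a $\pi$-network for $X$ if every non-empty open set $U\subseteq X$ contains some $A\in\lambda$. A subset $A\subseteq X$ is a $C$-compact subset of $X$ if $f(A)$ is compact in $\mathbb{R}$ for every $f\in C(X)$. $\lambda(C)$ denotes the family of all $A\in\lambda$ such that for every $C$-compact subset $B$ of $X$ with $B\subset A$, the set $[B,U]$ is open in $C_\lambda(X)$ for every open $U\subseteq\mathbb{R}$. $\lambda_m$ denotes the (unique) largest, with respect to inclusion, family $\mu$ of non-empty subsets of $X$ such that $C_{\mu}(X)=C_\lambda(X)$. A family $\mu$ of $C$-compact subsets of $X$ is hereditary with respect to $C$-compact subsets if whenever $A\in\mu$ and $B$ is a (non-empty) $C$-compact subset of $X$ with $B\subset A$, then $B\in\mu$. A paratopological group is a group with a topology for which the group operation is jointly continuous. *)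

(* Defs.v *)
From HB Require Import structures.
From mathcomp Require Import all_boot all_order all_algebra finmap.
From mathcomp Require Import all_classical all_reals all_analysis.

Set Implicit Arguments.
Unset Strict Implicit.
Unset Printing Implicit Defensive.

Import Order.TTheory GRing.Theory Num.Theory.
Import numFieldNormedType.Exports.

Local Open Scope classical_set_scope.
Local Open Scope ring_scope.

Section continuous_real_functions.
Context {R : realType} {X : topologicalType}.
Local Notation C := (continuousType X R).
Implicit Types f g h : C.

Let addf_cts f g : continuous (f \+ g).
Proof. by move=> x; apply: cvgD; exact: cts_fun. Qed.

Let oppf_cts f : continuous (\- f).
Proof. by move=> x; apply: cvgN; exact: cts_fun. Qed.

Let mulf_cts f g : continuous (f \* g).
Proof. by move=> x; apply: cvgM; exact: cts_fun. Qed.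

Let scalef_cts (k : R) f : continuous (fun x => k * f x).
Proof. by move=> x; apply: cvgM; [exact: cvg_cst|exact: cts_fun]. Qed.

Let addf f g : C := mkcts (@addf_cts f g).
Let oppf f : C := mkcts (@oppf_cts f).
Let mulf f g : C := mkcts (@mulf_cts f g).
Let scalef (k : R) f : C := mkcts (@scalef_cts k f).
Let zerof : C := cst 0.
Let onef : C := cst 1.

Let addfA : associative addf.
Proof. by move=> f g h; apply/continuousEP => x; exact: addrA. Qed.
Let addfC : commutative addf.
Proof. by move=> f g; apply/continuousEP => x; exact: addrC. Qed.
Let add0f : left_id zerof addf.
Proof. by move=> f; apply/continuousEP => x; exact: add0r. Qed.
Let addNf : left_inverse zerof oppf addf.
Proof. by move=> f; apply/continuousEP => x; exact: addNr. Qed.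

HB.instance Definition _ := GRing.isZmodule.Build C addfA addfC add0f addNf.

Let mulfA : associative mulf.
Proof. by move=> f g h; apply/continuousEP => x; exact: mulrA. Qed.
Let mulfC : commutative mulf.
Proof. by move=> f g; apply/continuousEP => x; exact: mulrC. Qed.
Let mul1f : left_id onef mulf.
Proof. by move=> f; apply/continuousEP => x; exact: mul1r. Qed.
Let mulf1 : right_id onef mulf.
Proof. by move=> f; apply/continuousEP => x; exact: mulr1. Qed.
Let mulfDl : left_distributive mulf addf.
Proof. by move=> f g h; apply/continuousEP => x; exact: mulrDl. Qed.
Let mulfDr : right_distributive mulf addf.
Proof. by move=> f g h; apply/continuousEP => x; exact: mulrDr. Qed.

HB.instance Definition _ :=
  GRing.Zmodule_isPzRing.Build C mulfA mul1f mulf1 mulfDl mulfDr.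
HB.instance Definition _ := GRing.PzRing_hasCommutativeMul.Build C mulfC.

Let scalefA a b f : scalef a (scalef b f) = scalef (a * b) f.
Proof. by apply/continuousEP => x; exact: mulrA. Qed.
Let scale1f : left_id 1 scalef.
Proof. by move=> f; apply/continuousEP => x; exact: mul1r. Qed.
Let scalefDr : right_distributive scalef +%R.
Proof. by move=> a f g; apply/continuousEP => x; exact: mulrDr. Qed.
Let scalefDl f : {morph scalef^~ f : a b / a + b}.
Proof. by move=> a b; apply/continuousEP => x; exact: mulrDl. Qed.

HB.instance Definition _ :=
  GRing.Zmodule_isLmodule.Build R C scalefA scale1f scalefDr scalefDl.

Lemma ctsfunD f g x : (f + g) x = f x + g x. Proof. by []. Qed.
Lemma ctsfunN f x : (- f) x = - f x. Proof. by []. Qed.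
Lemma ctsfunM f g x : (f * g) x = f x * g x. Proof. by []. Qed.
Lemma ctsfunZ (k : R) f x : (k *: f) x = k * f x. Proof. by []. Qed.

End continuous_real_functions.

HB.structure Definition PreTopologicalPzRing :=
  {M of Topological M & GRing.PzRing M}.

Definition paratopological_group (E : PreTopologicalZmodule.type) :=
  continuous (fun x : E * E => x.1 + x.2).

Definition topological_group (E : PreTopologicalZmodule.type) :=
  paratopological_group E /\ continuous (-%R : E -> E).

Definition topological_ring (E : PreTopologicalPzRing.type) :=
  topological_group E /\ continuous (fun x : E * E => x.1 * x.2).

Section topological_modules.
Context (R : numFieldType).

Definition topological_vector_space (E : preTopologicalLmodType R) :=
  topological_group E /\ continuous (fun z : R^o * E => z.1 *: z.2).

Definition locally_convex_tvs (E : preTopologicalLmodType R) :=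
  topological_vector_space E /\
  exists2 B : set_system E, (forall b, b \in B -> convex_set b) & basis B.

(* The product is a parameter: the library's lalgType requires 1 != 0, which
   fails in C(X) when X is empty. *)
Definition topological_algebra (E : preTopologicalLmodType R)
    (mul : E -> E -> E) :=
  [/\ associative mul,
      forall (a : R) (x y z : E), mul (a *: x + y) z = a *: mul x z + mul y z,
      forall (a : R) (x y z : E), mul z (a *: x + y) = a *: mul z x + mul z y,
      topological_vector_space E
    & continuous (fun x : E * E => mul x.1 x.2)].

End topological_modules.

Definition tychonoff_space (X : topologicalType) :=
  completely_regular_space X /\ hausdorff_space X.

Definition pi_network {X : topologicalType} (lambda : set (set X)) :=
  forall U, open U -> U !=set0 -> exists2 A, lambda A & A `<=` U.

Definition nonempty_family {X : Type} (lambda : set (set X)) :=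
  forall A, lambda A -> A !=set0.

Section function_space_topologies.
Context (R : realType) {X : topologicalType}.
Implicit Types (lambda mu : set (set X)) (A B F : set X) (U : set R).

Definition maps_into F U : set (continuousType X R) := [set f | f @` F `<=` U].

Definition C_open lambda : Type := continuousType X R.
HB.instance Definition _ lambda :=
  GRing.ComPzRing.copy (C_open lambda) (continuousType X R).
HB.instance Definition _ lambda :=
  GRing.Lmodule.copy (C_open lambda) (continuousType X R).
HB.instance Definition _ lambda :=
  isSubBaseTopological.Build (C_open lambda)
    [set FU : set X * set R | lambda FU.1 /\ open FU.2]
    (fun FU => maps_into FU.1 FU.2).

Definition C_unif lambda : Type := continuousType X R.
HB.instance Definition _ lambda :=
  Uniform.copy (C_unif lambda)
    (initial_topology (id : continuousType X R -> {family lambda, X -> R})).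

(* The supremum is taken in \bar R : it is +oo when f - g is unbounded on F. *)
Definition unif_nbhd (f : continuousType X R) F (e : R) :
    set (continuousType X R) :=
  [set g | (ereal_sup [set `|f x - g x|%:E | x in F] < e%:E)%E].

Definition C_compact A :=
  forall f : continuousType X R, compact (f @` A).

Definition C_compact_family lambda := lambda `<=` C_compact.

Definition C_hereditary mu :=
  forall A B, mu A -> B !=set0 -> C_compact B -> B `<=` A -> mu B.

Definition lambda_C lambda : set (set X) :=
  [set A | lambda A /\
    forall B, C_compact B -> B `<=` A ->
    forall U, open U -> open (maps_into B U : set (C_open lambda))].

Definition same_C_open mu lambda :=
  forall W : set (continuousType X R),
    open (W : set (C_open mu)) <-> open (W : set (C_open lambda)).

Definition largest_family lambda mu :=
  [/\ nonempty_family mu, same_C_open mu lambda &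
      forall nu, nonempty_family nu -> same_C_open nu lambda -> nu `<=` mu].

Definition lambda_m lambda : set (set X) := get (largest_family lambda).

Lemma open_maps_into lambda A U : lambda A -> open U ->
  open (maps_into A U : set (C_open lambda)).
Proof.
move=> lA oU; exists [set maps_into A U]; last by rewrite bigcup_set1.
move=> _ ->; exists [fset (A, U)]%fset.
  by move=> FU; rewrite !inE => /eqP ->.
by rewrite set_fset1 bigcap_set1.
Qed.

Lemma C_open_finer lambda mu :
  (forall A U, lambda A -> open U ->
    open (maps_into A U : set (C_open mu))) ->
  forall W : set (continuousType X R),
    open (W : set (C_open lambda)) -> open (W : set (C_open mu)).
Proof.
move=> oi _ [D sD <-]; rewrite openE => t [B DB Bt].
suff iB : nbhs (t : C_open mu) B by apply: filterS iB => u Bu; exists B.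
have [F sF FB] := sD _ DB; rewrite -FB in Bt *.
apply: filter_bigI => FU FUF; have := sF _ FUF; rewrite inE => -[lF oF].
by apply: open_nbhs_nbhs; split; [exact: oi|exact: Bt].
Qed.

Lemma lambda_mP lambda : nonempty_family lambda ->
  largest_family lambda (lambda_m lambda).
Proof.
move=> l0; apply: (getPex (P := largest_family lambda)).
exists [set A | A !=set0 /\ forall U, open U ->
  open (maps_into A U : set (C_open lambda))]; split.
- by move=> A [].
- move=> W; split.
  + by apply: C_open_finer => A U [_ oA]; exact: oA.
  + apply: C_open_finer => A U lA oU.
    apply: open_maps_into => //; split; [exact: l0|move=> V].
    exact: open_maps_into.
- move=> nu nu0 nul A nuA; split; first exact: nu0.
  by move=> U oU; apply/nul; exact: open_maps_into.
Qed.

Lemma largest_family_uniq lambda mu nu :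
  largest_family lambda mu -> largest_family lambda nu -> mu = nu.
Proof.
move=> [mu0 mul muM] [nu0 nul nuM].
by apply/seteqP; split; [exact: nuM|exact: muM].
Qed.

Lemma unif_nbhd_lt (f g : continuousType X R) F (e : R) x : unif_nbhd f F e g -> F x -> `|f x - g x| < e.
Proof.
move=> /= fge Fx; rewrite -lte_fin; apply: le_lt_trans fge.
by apply: ereal_sup_ubound; exists x.
Qed.

Lemma lt_unif_nbhd (f g : continuousType X R) F (e d : R) : d < e ->
  (forall x, F x -> `|f x - g x| < d) -> unif_nbhd f F e g.
Proof.
move=> de fgd; apply: (@le_lt_trans _ _ d%:E); last by rewrite lte_fin.
by apply: ge_ereal_sup => _ [x Fx <-]; rewrite lee_fin ltW// fgd.
Qed.

(* For a directed lambda, the sets <f, F, e> form a neighbourhood base at f. *)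
Lemma C_unif_nbhs lambda : lambda !=set0 -> setU_closed lambda ->
  forall (f : C_unif lambda) (W : set (C_unif lambda)),
  nbhs f W <-> exists (F : set X) (e : R), [/\ lambda F, 0 < e & unif_nbhd f F e `<=` W].
Proof.
move=> [F0 lF0] lU f W; split; last first.
  move=> [F] [e] [lF e0 FW].
  have fF := @initial_continuous _ _
    (id : continuousType X R -> {family lambda, X -> R}) f.
  have e20 : 0 < e / 2 by rewrite divr_gt0.
  have fe : nbhs f [set g : C_unif lambda |
      forall y, F y -> ball (f y : R) (e / 2) (g y)].
    exact: (fF _ (fam_nbhs (f : {family lambda, X -> R})
      (entourage_ball R (PosNum e20)) lF)).
  apply: filterS fe => g fg; apply: FW.
  apply: (@lt_unif_nbhd f g F e (e / 2)) => [|x Fx].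
    by rewrite ltr_pdivrMr// ltr_pMr// ltr1n.
  by have := fg x Fx; rewrite -ball_normE.
pose D : set (set X * R) := [set Fe | lambda Fe.1 /\ 0 < Fe.2].
pose G := filter_from D (fun Fe => unif_nbhd f Fe.1 Fe.2).
have GF : Filter G.
  apply: filter_from_filter; first by exists (F0, 1); split => //=.
  move=> [A a] [B b] [/= lA a0] [/= lB b0]; exists (A `|` B, Num.min a b).
    by split => /=; [exact: lU|rewrite lt_min a0].
  have sub K (e d : R) L g : K `<=` L -> e <= d ->
      unif_nbhd f L e g -> unif_nbhd f K d g.
    move=> KL ed /= fg; apply: (lt_le_trans (y := e%:E)); last by rewrite lee_fin.
    apply: le_lt_trans fg; apply: ereal_sup_le => _ [x Kx <-].
    by exists x => //; exact: KL.
  move=> g fg; split; apply: sub fg => //=.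
  - by rewrite ge_min lexx.
  - by rewrite ge_min lexx orbT.
have Gf : {family lambda,
    (id : continuousType X R -> X -> R) @ G --> (f : X -> R)}.
  apply/fam_cvgP => A lA V /uniform_nbhs [E [entE EV]].
  have := entE; rewrite -entourage_ballE => -[e /= e0 eE].
  exists (A, e); first by split.
  move=> g fg /=; apply: EV => y Ay; apply: eE => /=.
  by rewrite -ball_normE /=; exact: unif_nbhd_lt fg Ay.
rewrite nbhsE => -[_ [[B oB <-] Bf] BW].
have [[F e] [/= lF e0] FB] : G (id @^-1` B).
  by apply: (Gf B); apply: open_nbhs_nbhs.
by exists F, e; split => // g /FB /BW.
Qed.

End function_space_topologies.

(* Main.v *)
Require Import Defs.
From mathcomp Require Import all_boot all_order all_algebra lra ring.
From mathcomp Require Import all_classical all_reals all_analysis.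

Import Order.TTheory GRing.Theory Num.Theory numFieldNormedType.Exports.

Local Open Scope classical_set_scope.
Local Open Scope ring_scope.

(** Everything turns on comparing the set-open topology on [C(X)] with the
uniform neighbourhoods [tube f F e] (the [g] with [|f - g| < e] on [F]) of
members [F] of [lambda]. Write [[F, U]] for [maps_into F U].

A set [A] is C-compact exactly when every continuous [h] without zero on [A] is
bounded away from zero on [A] ([C_compactP]): this makes all images [f(A)]
closed, and bounded too, since [1 / (1 + |f|)] has no zero. Hence the trace on
a C-compact set of a sublevel set [f <= a] is C-compact
([C_compact_sublevel]).

Suppose addition is jointly continuous. Translations are then continuous, and
so is the map sending a real to the constant function. If [h] has no zero on
[F], and [[F, U]] is open for all open [U], then [h] lies in the open set
[[F, R \ {0}]], so [h + t] has no zero on [F] for all small reals [t]; that is,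
[h] is bounded away from zero on [F]. Thus [F] is C-compact
([paratop_C_compact]). If moreover [B] is a C-compact subset of [F] and [f]
lies in [[B, U]], then [f + [F, (-e, e)]] is a neighbourhood of [f] which, for
small [e], lies in [[B, U]] by compactness of [f(B)]; hence [[B, U]] is open
([paratop_maps_into_open_sub]). Applied to the members of [lambda] this shows
that they are C-compact and that [lambda = lambda_C]. Since [lambda_m] consists
of the non-empty [F] for which all [[F, U]] are open ([lambda_mE]), it also shows
that [lambda_m] consists of C-compact sets and is hereditary.

Conversely, assume that [lambda] consists of C-compact sets and that
[lambda = lambda_C]. If [F] is in [lambda] and [f] in [[F, U]], compactness of
[f(F)] puts a tube around [f] inside [[F, U]]. In the other direction, cut [F]
into finitely many pieces [B] on which [f] is within [e / 4] of a constant [y];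
each is C-compact, so [[B, (y - e/2, y + e/2)]] is open, and a function in all of
these sets lies in [tube f F e]. So tubes form a neighbourhood base
([C_compact_tube_base]), as they do for uniform convergence on the members of
[lambda]; so the two topologies coincide. Once tubes are a base, continuity of
addition is immediate; multiplication and scaling are continuous because
continuous functions are bounded on C-compact sets, and local convexity holds
because tubes are convex and open.

Finally, [lambda] is contained in [lambda_m], so C-compactness and heredity of
[lambda_m] give the C-compactness of the members of [lambda] and the openness
of [[B, U]] for their C-compact subsets [B]. *)

(** * C-compact sets *)

Section C_compact_sets.
Context {R : realType} {X : topologicalType}.
Local Notation C := (continuousType X R).
Implicit Types (f g h : C) (A B : set X) (U : set R) (e : R).

(** The inequality is required at each point, not for the supremum, which
avoids extended reals; for neighbourhood bases the two forms are
interchangeable at the cost of shrinking [e]. *)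
Definition tube f A e : set C := [set g | forall x, A x -> `|f x - g x| < e].

Lemma maps_into0 U : maps_into set0 U = [set: C].
Proof. by apply/seteqP; split=> [g //|g _ y [x]]. Qed.

Lemma norm_cts f : continuous (fun x => `|f x|).
Proof. by move=> x; apply: cvg_norm; exact: cts_fun. Qed.

Definition norm_fun f : C := mkcts (norm_cts f).

Lemma inv_succ_norm_cts f : continuous (fun x => (1 + `|f x|)^-1).
Proof.
move=> x; apply: cvgV; first by rewrite gt_eqF// ltr_pwDl.
by apply: cvgD; [exact: cvg_cst|exact: (norm_cts f)].
Qed.

(** A compact [f(A)] has a positive distance to the complement of [U]. *)
Lemma compact_image_tube f A U : compact (f @` A) -> open U ->
  maps_into A U f -> exists2 e, 0 < e & tube f A e `<=` maps_into A U.
Proof.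
move=> /compact_near_coveringP cA oU fU.
have [y /fU Uy|e /= e0 eA] := cA R (0 : R)^'+
    (fun e y => forall z, `|y - z| < e -> U z) _.
  have /nbhs_ballP[d /= d0 dU] : nbhs y U by exact: open_nbhs_nbhs.
  exists (ball y (d / 2), [set e : R | e < d / 2]) => /=.
    split; first by apply: nbhsx_ballx; rewrite divr_gt0.
    by apply: nbhs_right_lt; rewrite divr_gt0.
  move=> [y' e] /= [yy' ed] z y'z; apply: dU.
  by apply: (@ball_splitr _ _ y'); [exact: ball_sym|apply: lt_trans ed].
exists (e / 2); first by rewrite divr_gt0.
move=> g fg _ [x Ax <-].
have e2 : e / 2 < e by rewrite ltr_pdivrMr// ltr_pMr// ltr1n.
have e20 : 0 < e / 2 by rewrite divr_gt0.
apply: (eA (e / 2) _ _ (f x)) => //=; last exact: fg.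
  by rewrite sub0r normrN gtr0_norm.
by exists x.
Qed.

(** Reduces C-compactness, a condition on all images, to one about zeros, in
which several functions can be combined into one by adding absolute values. *)
Lemma C_compactP A : C_compact R A <->
  forall h, (forall x, A x -> h x != 0) ->
    exists2 e, 0 < e & forall x, A x -> e <= `|h x|.
Proof.
split=> [cA h h0|away f].
  (* A small value [h x] would be removed by subtracting the constant [h x],
     which stays in the tube around [h]. *)
  have [||e e0 eA] := compact_image_tube h A [set y | y != 0] (cA h).
  - exact: open_neq.
  - by move=> _ [x Ax <-] /=; exact: h0.
  exists e => // x Ax; rewrite leNgt; apply/negP => hxe.
  have /eqP[] : (h - (cst (h x) : C)) x != 0.
    apply: eA; last by exists x.
    by move=> y Ay; rewrite ctsfunD ctsfunN opprD opprK addrA subrr add0r.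
  by rewrite ctsfunD ctsfunN subrr.
(* Boundedness of [f] on [A] comes from [1 / (1 + |f|)], closedness of [f(A)]
   from the functions [f - y] with [y] outside [f(A)]. *)
have [e e0 eA] : exists2 e, 0 < e & forall x, A x -> e <= (1 + `|f x|)^-1.
  have [x _|e e0 eA] := away (mkcts (inv_succ_norm_cts f)).
    by rewrite invr_neq0// gt_eqF// ltr_pwDl.
  exists e => // x /eA; rewrite /= ger0_norm// invr_ge0.
  by rewrite addr_ge0.
apply: (@subclosed_compact _ _ `[- e^-1, e^-1]%classic);
  [|exact: segment_compact|].
  move=> y cly; apply: contrapT => fAy.
  have [x Ax|d d0 dA] := away (f - (cst y : C)).
    rewrite ctsfunD ctsfunN subr_eq0; apply/eqP => fxy.
    by apply: fAy; exists x.
  have [_ [[x Ax <-]]] := cly _ (nbhsx_ballx y d d0).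
  by rewrite -ball_normE /= distrC ltNge dA.
move=> _ [x Ax <-] /=; rewrite in_itv /= -ler_norml.
apply: (@le_trans _ _ (1 + `|f x|)); first by rewrite lerDr.
have fx0 : 0 < 1 + `|f x| by rewrite ltr_pwDl.
rewrite -[leLHS]invrK lef_pV2 ?posrE ?invr_gt0//.
exact: eA.
Qed.

(** The function [|f - a| + (f - a)] vanishes exactly where [f <= a]. If [h] has
no zero on the sublevel set, its sum with [|h|] has no zero on [A], hence is
bounded away from zero on [A]; on the sublevel set this sum is [|h|]. *)
Lemma C_compact_sublevel A f a : C_compact R A ->
  C_compact R (A `&` [set x | f x <= a]).
Proof.
move=> /C_compactP cA; apply/C_compactP => h h0.
pose u := f - (cst a : C).
have uE x : (norm_fun h + (norm_fun u + u)) x =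
    `|h x| + (`|f x - a| + (f x - a)) by [].
have u0 x : 0 <= `|f x - a| + (f x - a).
  by rewrite -lerBlDr sub0r -normrN ler_norm.
have [x Ax|e e0 eA] := cA (norm_fun h + (norm_fun u + u)).
  rewrite uE; have [fxa|fxa] := leP (f x) a.
    by rewrite gt_eqF// ltr_pwDl// normr_gt0 h0.
  by rewrite gt_eqF// ltr_wpDl// ltr_wpDl// subr_gt0.
exists e => // x [Ax /= fxa]; have := eA _ Ax.
rewrite uE [X in _ + (X + _)]ler0_norm ?subr_le0// addNr addr0.
by rewrite normr_id.
Qed.

End C_compact_sets.

(** * Consequences of continuity of addition for the set-open topology *)

Section set_open_topology.
Context {R : realType} {X : topologicalType} (lambda : set (set X)).
Local Notation C := (continuousType X R).
Local Notation E := (C_open R lambda).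
Implicit Types (f g h : C) (A B F : set X) (U : set R) (e : R).

(** Convergence only has to be tested on the subbase. *)
Lemma C_open_cvg (G : set_system C) f : Filter G ->
  (forall F U, lambda F -> open U -> maps_into F U f -> G (maps_into F U)) ->
  G --> (f : E).
Proof.
move=> FG GS W; rewrite nbhsE => -[_ [[D sD <-] [B DB Bf]] BW].
apply: filterS BW _.
suff GB : G B by apply: filterS GB => g Bg; exists B.
have [S sS SB] := sD _ DB; rewrite -SB in Bf *.
apply: filter_bigI => FU FUS; have := sS _ FUS; rewrite inE => -[lF oU].
by apply: GS => //; exact: Bf.
Qed.

Lemma cst_continuous_C_open : continuous (fun t : R => (cst t : C) : E).
Proof.
move=> t; apply: C_open_cvg => F U lF oU tU.
have [[x Fx]|/nonemptyPn F0] := pselect (F !=set0); last first.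
  by rewrite F0 maps_into0; exact: filterT.
have Ut : U t by apply: tU; exists x.
by apply: filterS (open_nbhs_nbhs (conj oU Ut)) => s Us _ [y _ <-].
Qed.

Definition maps_into_open F :=
  forall U, open U -> open (maps_into F U : set E).

Section paratopological.
Hypothesis addE : paratopological_group E.

Lemma paratop_translation f : continuous (fun g : E => (g + f : E)).
Proof.
move=> g W /(addE (g, f)) [[P Q] /= [gP fQ] PQ].
apply: (@filterS E _ _ P) gP => h Ph.
by apply: (PQ (h, f)); split => //; exact: nbhs_singleton fQ.
Qed.

(** Adding a small constant to [h] stays in the open set [[F, R \ {0}]], so
no value of [h] on [F] is small. *)
Lemma paratop_C_compact F : maps_into_open F -> C_compact R F.
Proof.
move=> oF; apply/C_compactP => h h0.
pose V := maps_into F [set y : R | y != 0].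
have Vh : nbhs ((cst 0 : C) : E) [set g : E | V (g + h)].
  apply: (paratop_translation h); apply: open_nbhs_nbhs.
  split; first by apply: oF; exact: open_neq.
  by move=> _ [x Fx <-]; rewrite /= ctsfunD add0r; exact: h0.
have /nbhs_ballP[e /= e0 eV] := @cst_continuous_C_open _ _ Vh.
exists e => // x Fx; rewrite leNgt; apply/negP => hxe.
have : V ((cst (- h x) : E) + h).
  by apply: eV; rewrite -ball_normE /= sub0r opprK.
move=> /(_ _ (imageP _ Fx)) /=; rewrite ctsfunD addNr.
by rewrite eqxx.
Qed.

(** Translating [[F, (-e, e)]] to [f] gives uniform closeness to [f] on [F],
hence on [B]. *)
Lemma paratop_maps_into_open_sub F B : maps_into_open F ->
  B `<=` F -> C_compact R B -> maps_into_open B.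
Proof.
move=> oF BF cB U oU; rewrite openE => f fU.
have [e e0 eU] := compact_image_tube f B U (cB f) oU fU.
have : nbhs (f : E) [set g : E | maps_into F (ball 0 e) (g - f)].
  apply: (paratop_translation (- f) f).
  apply: open_nbhs_nbhs; split; first by apply: oF; exact: ball_open.
  by move=> _ [x Fx <-]; rewrite /= ctsfunD ctsfunN subrr; exact: ballxx.
apply: filterS => g fg; apply: eU => x Bx.
have := fg _ (imageP _ (BF _ Bx)).
by rewrite -ball_normE /= sub0r normrN distrC.
Qed.

End paratopological.
End set_open_topology.

(** * Tubes as a neighbourhood base *)

Lemma mul_near {R : realType} (a b a' b' M N d : R) :
  `|a| <= M -> `|b| <= N -> `|a - a'| < d -> `|b - b'| < d -> d <= 1 ->
  `|a * b - a' * b'| < d * (M + N + 1).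
Proof.
move=> aM bN ad bd d1.
have -> : a * b - a' * b' = a * (b - b') + (a - a') * b - (a - a') * (b - b').
  by ring.
apply: le_lt_trans (ler_normB _ _) _.
apply: le_lt_trans (lerD (ler_normD _ _) (lexx _)) _; rewrite !normrM.
have h1 : `|a| * `|b - b'| <= M * d by apply: ler_pM => //; exact: ltW.
have h2 : `|a - a'| * `|b| <= d * N by apply: ler_pM => //; exact: ltW.
have h3 : `|a - a'| * `|b - b'| < d.
  apply: le_lt_trans ad; rewrite ler_piMr//.
  exact: le_trans (ltW bd) d1.
lra.
Qed.

Section tube_bases.
Context {R : realType} {X : topologicalType} (lambda : set (set X)).
Local Notation C := (continuousType X R).
Local Notation E := (C_open R lambda).
Implicit Types (f g h : C) (F : set X) (e : R) (W : set C).

(** The alternative [F = set0], whose tube is all of [C(X)], covers an empty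
[lambda], which occurs when [X] is empty. *)
Definition tube_base (N : C -> set_system C) :=
  forall f W, N f W <->
    exists F e, [/\ F = set0 \/ lambda F, 0 < e & tube f F e `<=` W].

Lemma C_unif_tube_base : (X -> lambda !=set0) -> setU_closed lambda ->
  tube_base (@nbhs _ (C_unif R lambda)).
Proof.
move=> X0 lU f W; have [l0|l0] := pselect (lambda !=set0).
  rewrite (C_unif_nbhs l0 lU f W); split=> [|[F [e [[->|lF] e0 FW]]]].
  - move=> [F [e [lF e0 FW]]]; exists F, (e / 2); split.
    + by right.
    + by rewrite divr_gt0.
    + move=> g fg; apply: FW; apply: lt_unif_nbhd fg.
      by rewrite ltr_pdivrMr// ltr_pMr// ltr1n.
  - have [A lA] := l0; exists A, 1; split => // g _; exact: FW.
  - exists F, e; split => // g fg; apply: FW => x Fx.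
    exact: unif_nbhd_lt fg Fx.
have C1 g : g = f by apply/continuousEP => x; case: l0; exact: X0.
split=> [fW|[F [e [_ e0 FW]]]].
  exists set0, 1; split => //; first by left.
  by move=> g _; rewrite (C1 g); exact: nbhs_singleton fW.
suff -> : W = setT by exact: filterT.
apply/seteqP; split => // g _; rewrite (C1 g); apply: FW => x.
by rewrite subrr normr0.
Qed.

(** The finite subdivision of [F] is carried by compactness of [f(F)] in the form
of near coverings: it is enough to find, for each [y], a neighbourhood of [f]
that controls all points [x] of [F] with [f x] near [y]. The set
[[B, (y - e/2, y + e/2)]] does this, where [B] is the C-compact set of points of
[F] at which [f] is within [e / 4] of [y]. *)
Lemma C_compact_tube_base : setU_closed lambda -> C_compact_family R lambda ->
  lambda `<=` lambda_C R lambda -> tube_base (@nbhs _ E).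
Proof.
move=> lU lC lS f W; split=> [fW|[F [e [[->|lF] e0 FW]]]]; last 2 first.
- suff -> : W = setT by exact: (@filterT E).
  by apply/seteqP; split => // g _; exact: FW.
- have /compact_near_coveringP cF := lC F lF f.
  pose near_on g y := forall x, F x -> f x = y -> `|f x - g x| < e.
  apply: (@filterS E _ _ _ _ _ (cF E (nbhs (f : E)) near_on _ _)).
    by move=> g fg; apply: FW => x Fx; apply: (fg (f x)) => //; exists x.
  move=> y _; have e40 : 0 < e / 4 by rewrite divr_gt0.
  pose B := F `&` [set x | norm_fun (f - (cst y : C)) x <= e / 4].
  exists (ball y (e / 4), maps_into B (ball y (e / 2))).
    split=> /=; first exact: nbhsx_ballx.
    apply: open_nbhs_nbhs; split.
      apply: (lS F lF).2; last exact: ball_open.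
      - exact: C_compact_sublevel (lC F lF).
      - by move=> x [].
    move=> _ [x [_ /= fy] <-]; rewrite -ball_normE /= distrC.
    apply: le_lt_trans fy _; lra.
  move=> [y1 g] /= [+ gB] x Fx fxy; rewrite -fxy -ball_normE /= distrC => fy.
  have /gB : (g @` B) (g x) by exists x => //; split => //=; exact: ltW.
  rewrite -ball_normE /= => gy.
  rewrite -[f x](subrK y) -addrA; apply: le_lt_trans (ler_normD _ _) _; lra.
pose D : set (set X * R) :=
  [set Fe | (Fe.1 = set0 \/ lambda Fe.1) /\ 0 < Fe.2].
pose G := filter_from D (fun Fe => tube f Fe.1 Fe.2).
have FG : Filter G.
  apply: filter_from_filter.
    by exists (set0, 1); split => //=; left.
  move=> [A a] [B b] [/= lA a0] [/= lB b0].
  exists (A `|` B, Num.min a b).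
    split => /=; last by rewrite lt_min a0.
    case: lA lB => [->|lA] [->|lB]; rewrite ?set0U ?setU0.
    - by left.
    - by right.
    - by right.
    - by right; exact: lU.
  move=> g /= fg; split => x Fx.
    by have := fg x (or_introl Fx); rewrite lt_min => /andP[].
  by have := fg x (or_intror Fx); rewrite lt_min => /andP[].
have Gf : G --> (f : E).
  apply: C_open_cvg => F U lF oU fU.
  have [e e0 eU] := compact_image_tube f F U (lC F lF f) oU fU.
  by exists (F, e) => //; split => //; right.
have : G W by exact: Gf.
by move=> [[F e] [lF e0] FW]; exists F, e.
Qed.

Section operations.
Hypothesis tb : tube_base (@nbhs _ E).

Lemma nbhs_tube f F e : F = set0 \/ lambda F -> 0 < e ->
  nbhs (f : E) (tube f F e).
Proof. by move=> lF e0; apply: (tb f _).2; exists F, e; split. Qed.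

Lemma tube_base_paratop : paratopological_group E.
Proof.
move=> [f g] W /tb[F [e [lF e0 FW]]] /=.
have e20 : 0 < e / 2 by rewrite divr_gt0.
exists (tube f F (e / 2), tube g F (e / 2)).
  by split; exact: nbhs_tube.
move=> [f' g'] /= [ff gg]; apply: FW => x Fx.
rewrite !ctsfunD opprD addrACA.
apply: le_lt_trans (ler_normD _ _) _.
by have := ff x Fx; have := gg x Fx; lra.
Qed.

Lemma tube_base_topgroup : topological_group E.
Proof.
split; first exact: tube_base_paratop.
move=> f W /tb[F [e [lF e0 FW]]].
apply: (@filterS E _ _ (tube f F e)) (nbhs_tube f F e lF e0) => g fg.
by apply: FW => x Fx; rewrite !ctsfunN -opprD normrN; exact: fg.
Qed.

Hypothesis lC : C_compact_family R lambda.

Lemma C_compact_bounded F f : F = set0 \/ lambda F ->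
  exists2 M : R, 0 < M & forall x, F x -> `|f x| <= M.
Proof.
move=> [->|lF]; first by exists 1.
have [M [Mr MF]] := compact_bounded (lC F lF f).
exists (Num.max M 0 + 1); first by rewrite ltr_wpDl// le_max lexx orbT.
move=> x Fx; apply: (MF (Num.max M 0 + 1)) => //.
by rewrite ltr_pwDr// le_max lexx.
Qed.

Lemma tube_base_mul : continuous (fun z : E * E => z.1 * z.2).
Proof.
move=> [f g] W /tb[F [e [lF e0 FW]]] /=.
have [M M0 fM] := C_compact_bounded F f lF.
have [N N0 gN] := C_compact_bounded F g lF.
pose d := Num.min 1 (e / (M + N + 1)).
have S0 : 0 < M + N + 1 by rewrite !addr_gt0.
have d0 : 0 < d by rewrite lt_min ltr01 divr_gt0.
exists (tube f F d, tube g F d); first by split; exact: nbhs_tube.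
move=> [f' g'] /= [ff gg]; apply: FW => x Fx; rewrite !ctsfunM.
have fd := ff x Fx; have gd := gg x Fx.
have d1 : d <= 1 by rewrite ge_min lexx.
have dS : d * (M + N + 1) <= e.
  by rewrite -ler_pdivlMr// ge_min lexx orbT.
by apply: lt_le_trans dS; apply: mul_near => //; [exact: fM|exact: gN].
Qed.

(** Scaling by [k] is multiplication by the constant function [k]. *)
Lemma tube_base_tvs : topological_vector_space E.
Proof.
split; first exact: tube_base_topgroup.
move=> [k f] W /= kfW.
have kE (t : R) (h : C) : (t *: h : C) = (cst t : C) * h by apply/continuousEP.
have kfW' : nbhs (((cst k : C) : E) * (f : E)) W by rewrite -kE.
have [[P Q] /= [nP nQ] PQ] := tube_base_mul ((cst k : C) : E, f : E) _ kfW'.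
exists ((fun t : R => (cst t : C)) @^-1` P, Q).
  by split => //; exact: (@cst_continuous_C_open _ _ _ _ _ nP).
move=> [t h] [/= Pt Qh]; have := PQ ((cst t : C) : E, h) (conj Pt Qh).
by rewrite /= -kE.
Qed.

(** A tube is the translate to [f] of the open set [[F, (-e, e)]]. *)
Lemma open_tube f F e : F = set0 \/ lambda F -> open (tube f F e : set E).
Proof.
move=> lF.
have -> : tube f F e = (fun g : E => (g - f : E)) @^-1` maps_into F (ball 0 e).
  apply/seteqP; split=> g fg.
    move=> _ [x Fx <-]; rewrite -ball_normE /= sub0r normrN distrC.
    exact: fg.
  move=> x Fx; have := fg _ (imageP _ Fx).
  by rewrite -ball_normE /= sub0r normrN distrC.
apply: open_comp.
  by move=> g _; exact: (paratop_translation lambda tube_base_paratop (- f)).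
case: lF => [->|lF]; last by apply: open_maps_into => //; exact: ball_open.
by rewrite maps_into0; exact: openT.
Qed.

Lemma convex_tube f F e : convex_set (tube f F e : set (convex_lmodType E)).
Proof.
apply/convex_setW => g h /set_mem fg /set_mem fh k k0 k1.
apply/mem_set => x Fx.
have -> : conv k g h x = k%:num * g x + (1 - k%:num) * h x by [].
have -> : f x - (k%:num * g x + (1 - k%:num) * h x) =
    k%:num * (f x - g x) + (1 - k%:num) * (f x - h x) by ring.
apply: le_lt_trans (ler_normD _ _) _.
have {}k1 : 0 < 1 - k%:num by rewrite subr_gt0.
rewrite !normrM (gtr0_norm k0) (gtr0_norm k1).
have := fg x Fx; have := fh x Fx; nra.
Qed.

(** The base of convex sets is that of all open convex sets, among which are the
tubes. *)
Lemma tube_base_lctvs : locally_convex_tvs E.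
Proof.
split; first exact: tube_base_tvs.
exists [set b | open (b : set E) /\ convex_set (b : set (convex_lmodType E))].
  by move=> b /set_mem[].
split=> [b []//|f W /tb[F [e [lF e0 FW]]]].
exists (tube f F e) => //=; split.
  by split; [exact: open_tube|exact: convex_tube].
by move=> x _; rewrite subrr normr0.
Qed.

Lemma tube_base_topring : topological_ring E.
Proof. by split; [exact: tube_base_topgroup|exact: tube_base_mul]. Qed.

Lemma tube_base_topalgebra : @topological_algebra R E *%R.
Proof.
split=> [|a f g h|a f g h||].
- exact: mulrA.
- by apply/continuousEP => x; rewrite !(ctsfunM, ctsfunD, ctsfunZ); ring.
- by apply/continuousEP => x; rewrite !(ctsfunM, ctsfunD, ctsfunZ); ring.
- exact: tube_base_tvs.
- exact: tube_base_mul.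
Qed.

End operations.
End tube_bases.

(** * The largest family and the equivalences *)

Section largest_family.
Context {R : realType} {X : topologicalType} (lambda : set (set X)).
Hypothesis lambda0 : nonempty_family lambda.

(** Adding to [lambda] a non-empty set [F] with all [[F, U]] open does not change
the topology, so [F] belongs to the largest family. *)
Lemma lambda_mE F :
  lambda_m R lambda F <-> F !=set0 /\ maps_into_open (R := R) lambda F.
Proof.
have [m0 ml mmax] := lambda_mP R lambda0.
split=> [mF|[F0 oF]].
  split; first exact: m0.
  by move=> U oU; apply/ml; exact: open_maps_into.
apply: (mmax (lambda `|` [set F])); last by right.
- by move=> A [/lambda0|->].
- move=> W; split; apply: C_open_finer => A U.
  + by move=> [lA|->] oU; [exact: open_maps_into|exact: oF].
  + by move=> lA oU; apply: open_maps_into => //; left.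
Qed.

End largest_family.

Theorem theorem3p1 (R : realType) (X : topologicalType) (lambda : set (set X))
    (tychX : tychonoff_space X)
    (lambda0 : nonempty_family lambda)
    (lambda_closed : lambda `<=` closed)
    (lambda_pi : pi_network lambda)
    (lambdaU : setU_closed lambda) :
  [<->
    forall W : set (continuousType X R),
      open (W : set (C_open R lambda)) <-> open (W : set (C_unif R lambda));
    paratopological_group (C_open R lambda);
    topological_group (C_open R lambda);
    topological_vector_space (C_open R lambda);
    locally_convex_tvs (C_open R lambda);
    topological_ring (C_open R lambda);
    @topological_algebra R (C_open R lambda) *%R;
    C_compact_family R lambda /\ lambda = lambda_C R lambda;
    C_compact_family R (lambda_m R lambda) /\
      C_hereditary R (lambda_m R lambda)].
Proof.
set E := C_open R lambda.
have X0 : X -> lambda !=set0.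
  move=> x; have [|A lA _] := lambda_pi setT openT; first by exists x.
  by exists A.
have unif_tb := @C_unif_tube_base R X lambda X0 lambdaU.
have tb_unif : tube_base lambda (@nbhs _ E) <->
    forall W : set (continuousType X R),
    open (W : set E) <-> open (W : set (C_unif R lambda)).
  split=> [tb W|oE f W].
    by rewrite !openE; split=> oW f /oW; move=> /tb/unif_tb || move=> /unif_tb/tb.
  split=> [|/unif_tb]; last first.
    by rewrite !nbhsE => -[B [/oE oB Bf] BW]; exists B.
  rewrite nbhsE => -[B [/oE oB Bf] BW]; apply/unif_tb.
  by rewrite nbhsE; exists B.
have para_compact : paratopological_group E ->
    C_compact_family R lambda /\ lambda = lambda_C R lambda.
  move=> addE.
  have oF F : lambda F -> maps_into_open (R := R) lambda F.
    by move=> lF U; exact: open_maps_into.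
  split=> [F lF|]; first exact: paratop_C_compact lambda addE _ (oF F lF).
  apply/seteqP; split=> [F lF|F []//]; split=> // B cB BF.
  exact: paratop_maps_into_open_sub lambda addE _ _ (oF F lF) BF cB.
have compact_tb : C_compact_family R lambda /\ lambda = lambda_C R lambda ->
    tube_base lambda (@nbhs _ E).
  by move=> [lC lS]; apply: C_compact_tube_base => //; rewrite -lS.
have para_tb := fun addE => compact_tb (para_compact addE).
tfae.
- by move=> /tb_unif; exact: tube_base_paratop.
- by move=> /para_tb; exact: tube_base_topgroup.
- move=> [addE _]; apply: tube_base_tvs; first exact: para_tb.
  by have [] := para_compact addE.
- move=> [[addE _] _]; apply: tube_base_lctvs; first exact: para_tb.
  by have [] := para_compact addE.
- move=> [[[addE _] _] _]; apply: tube_base_topring; first exact: para_tb.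
  by have [] := para_compact addE.
- move=> [[addE _] _]; apply: tube_base_topalgebra; first exact: para_tb.
  by have [] := para_compact addE.
- by move=> [_ _ _ [[addE _] _] _]; exact: para_compact.
- move=> /compact_tb/tube_base_paratop addE; split.
    by move=> F /lambda_mE[]// _; exact: paratop_C_compact.
  move=> F B /lambda_mE[]// _ oF B0 cB BF; apply/lambda_mE => //; split => //.
  exact: paratop_maps_into_open_sub oF BF cB.
- move=> [mC mH]; apply/tb_unif/compact_tb.
  have lm F : lambda F -> lambda_m R lambda F.
    move=> lF; apply/lambda_mE => //; split; first exact: lambda0.
    by move=> U; exact: open_maps_into.
  split=> [F /lm /mC//|]; apply/seteqP; split=> [F lF|F []//].
  split=> // B cB BF U oU.
  have [B0|/nonemptyPn ->] := pselect (B !=set0).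
    by have /lambda_mE[//|_] := mH F B (lm F lF) B0 cB BF; exact.
  by rewrite maps_into0; exact: openT.
Qed.
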